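(* Let $\ell$ and $q$ be positive integers with $\ell^2\leq 2q^2-2$. Put $r=q+\ell$, $b=2rq-1$ and $d=r^2-q^2$. Then there exists a Type 2 triangle $T_2(2,b,d)$; that is, $b\geq 3$, $2\leq d\leq b-1$, and there is a Pythagorean triangle with one leg of length $d^2$ and the other leg of length $d_{2,b}=d(b+1)$.
   Context: A Pythagorean triangle is a right triangle all of whose side lengths are positive integers. For integers $b\geq 3$, $2\leq d\leq b-1$ and $k\geq 2$, $d_{k,b}=d\,(b^{k-1}+\cdots+b+1)=\dfrac{d(b^k-1)}{b-1}$ denotes the positive integer whose base $b$ representation consists of $k$ digits all equal to $d$. A Pythagorean triangle is a Type 2 triangle with base $b$ repeated digits, denoted $T_2(k,b,d)$ (with $b\geq 3$, $2\leq d\leq b-1$, $k\geq 2$), if one of its legs has length $d^k$ and the other leg has length $d_{k,b}$. *)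

(* Defs.v *)
From mathcomp Require Import all_boot.

Set Implicit Arguments.
Unset Strict Implicit.
Unset Printing Implicit Defensive.

(* A right triangle with integer sides, given by its legs x, y and its
   hypotenuse z. *)
Definition pythagorean_triangle (x y z : nat) : Prop :=
  [/\ 0 < x, 0 < y, 0 < z & x ^ 2 + y ^ 2 = z ^ 2].

(* d_{k,b}: the number with k base-b digits, all equal to d. *)
Definition repdigit (k b d : nat) : nat := d * \sum_(i < k) b ^ i.

Lemma repdigit2 (b d : nat) : repdigit 2 b d = d * (b + 1).
Proof. by rewrite /repdigit !big_ord_recl big_ord0 expn0 expn1 addn0 addnC. Qed.

(* The triangle (x, y, z) is a T_2(k,b,d). Which of the two legs is d^k is
   left open. *)
Definition type2_triangle (k b d x y z : nat) : Prop :=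
  [/\ 3 <= b, 2 <= d <= b - 1, 2 <= k, pythagorean_triangle x y z
    & (x = d ^ k /\ y = repdigit k b d) \/ (x = repdigit k b d /\ y = d ^ k)].

(* Main.v *)
Require Import Defs.
From mathcomp Require Import all_boot.
From mathcomp Require Import zify ring.

(** The triangle is the one Euclid's formula gives for [(r, q)], scaled by [d]:
    its legs [r ^ 2 - q ^ 2 = d] and [2 * r * q = b + 1] become [d ^ 2] and
    [d * (b + 1)], the latter being the two-digit repdigit, and its hypotenuse
    becomes [d * (r ^ 2 + q ^ 2)]. Writing [d = l ^ 2 + 2 * q * l] and
    [b - 1 = 2 * q ^ 2 + 2 * q * l - 2], the bound [d <= b - 1] says exactly
    that [l ^ 2 <= 2 * q ^ 2 - 2]. *)

(* The subtractions are on nat; none of them truncates, since 0 < q and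
   q <= r. *)
Theorem mainTheorem6 (l q r b d : nat)
  (hl : 0 < l) (hq : 0 < q) (hlq : l ^ 2 <= 2 * q ^ 2 - 2)
  (hr : r = q + l) (hb : b = 2 * r * q - 1) (hd : d = r ^ 2 - q ^ 2) :
  exists x y z : nat, type2_triangle 2 b d x y z.
Proof.
have dE : d = l ^ 2 + 2 * (q * l).
  by rewrite hd hr sqrnD -addnA addnC addnK.
have bE : b + 1 = 2 * q ^ 2 + 2 * (q * l).
  have rq_gt0 : 0 < 2 * r * q by rewrite !muln_gt0 hq hr addn_gt0 hq.
  by rewrite hb subnK // hr; ring.
have l2_gt0 : 0 < l ^ 2 by rewrite expn_gt0 hl.
have ql_gt0 : 0 < q * l by rewrite muln_gt0 hq hl.
exists (d ^ 2), (d * (b + 1)), (d * (r ^ 2 + q ^ 2)).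
split=> //; [lia | lia | | by left; rewrite repdigit2].
have d_gt0 : 0 < d by lia.
split; first by rewrite expn_gt0 d_gt0.
- by rewrite muln_gt0 d_gt0 addn1.
- by rewrite muln_gt0 d_gt0 addn_gt0 !expn_gt0 hq orbT.
- by rewrite bE hr dE; ring.
Qed.
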